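(* There is a universal constant $c>0$ with the following property. Let $n\in\mathbb{N}$ and $L\ge 1$ satisfy $6L\le\sqrt[4]{n}$. Then there exists $\varepsilon>0$ such that for any $\varepsilon$-net $\mathcal{N}$ of the Euclidean unit sphere $S^{n-1}$ there exist a Banach space $(\mathbf{Y},\|\cdot\|_{\mathbf{Y}})$ and a $1$-Lipschitz mapping $f:\mathcal{N}\to\mathbf{Y}$ that satisfies $$\max_{a\in\mathcal{N}}\|F(a)-f(a)\|_{\mathbf{Y}}\ \ge\ c\,\frac{\sqrt{n}}{L}\,\varepsilon$$ for every $L$-Lipschitz mapping $F:S^{n-1}\to\mathbf{Y}$.
   Context: $S^{n-1}=\{x\in\mathbb{R}^n:\|x\|_{\ell_2^n}=1\}$ is the unit sphere of $\ell_2^n$ (that is, $\mathbb{R}^n$ with the Euclidean norm), equipped with the metric $\|x-y\|_{\ell_2^n}$. An $\varepsilon$-net of a metric space $(\mathcal{M},d)$ is a subset $\mathcal{N}\subseteq\mathcal{M}$ that is $\varepsilon$-separated ($d(a,b)\ge\varepsilon$ for all distinct $a,b\in\mathcal{N}$) and $\varepsilon$-dense ($\inf_{a\in\mathcal{N}}d(x,a)\le\varepsilon$ for every $x\in\mathcal{M}$). A mapping is $L$-Lipschitz if its Lipschitz constant is at most $L$. Banach spaces are over $\mathbb{R}$. *)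

(* Defs.v *)
From HB Require Import structures.
From mathcomp Require Export all_boot all_order all_algebra.
From mathcomp Require Export all_classical all_reals all_analysis.
Export Order.TTheory GRing.Theory Num.Theory numFieldNormedType.Exports.

Set Implicit Arguments.
Unset Strict Implicit.
Unset Printing Implicit Defensive.

Local Open Scope classical_set_scope.
Local Open Scope ring_scope.

(* The canonical norm `|x| on 'rV[R]_n is the sup norm, hence a separate
   Euclidean norm. *)
Definition l2norm (R : realType) (n : nat) (x : 'rV[R]_n) : R :=
  Num.sqrt (\sum_(i < n) x 0 i ^+ 2).

Definition l2dist (R : realType) (n : nat) (x y : 'rV[R]_n) : R :=
  l2norm (x - y).

Definition unit_sphere (R : realType) (n : nat) : set 'rV[R]_n :=
  [set x | l2norm x = 1].

Definition separated_set (R : realType) (T : Type) (d : T -> T -> R) (eps : R)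
    (N : set T) : Prop :=
  forall a b : T, N a -> N b -> a <> b -> eps <= d a b.

(* The infimum is taken in \bar R, so that it is +oo when N is empty (the
   real-valued inf would be 0): the empty set is not dense in a nonempty M. *)
Definition dense_subset (R : realType) (T : Type) (d : T -> T -> R) (eps : R)
    (M N : set T) : Prop :=
  forall x : T, M x ->
    (ereal_inf [set (d x a)%:E | a in N] <= eps%:E)%E.

Definition eps_net (R : realType) (T : Type) (d : T -> T -> R) (eps : R)
    (M N : set T) : Prop :=
  [/\ N `<=` M, separated_set d eps N & dense_subset d eps M N].

(* A mapping A -> Y is represented by a total function of which only the
   restriction to A matters. *)
Definition l2_lipschitz (R : realType) (n : nat) (Y : normedModType R) (L : R)
    (A : set 'rV[R]_n) (f : 'rV[R]_n -> Y) : Prop :=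
  forall x y : 'rV[R]_n, A x -> A y -> `|f x - f y| <= L * l2dist x y.

Definition is_max (R : realType) (A : set R) (m : R) : Prop :=
  A m /\ ubound A m.

(* Main.v *)
Require Import Defs.
From HB Require Import structures.
From mathcomp Require Import all_boot all_order all_algebra.
From mathcomp Require Import all_classical all_reals all_analysis.
From mathcomp Require Import ring lra.
Import Order.TTheory GRing.Theory Num.Theory numFieldNormedType.Exports.

(** Drop the first coordinate of a point y of the sphere to get y' in R^d,
    d = n - 1.  For a sign vector s in {-1, 1}^d, call <s, y'> / rho the phase
    of y in direction s, where rho = sqrt n eps / (7 L), and let f map y to the
    function s |-> (eps / 2) exp (i phase).

    Each value of f(y) has modulus eps / 2, so f cannot violate the
    1-Lipschitz condition on an eps-separated set as far as a single s is
    concerned.  Nevertheless f oscillates in the direction s (a vector of length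
    sqrt d) at the scale rho / sqrt d, which is comparable to eps / L, and this
    is what an L-Lipschitz map cannot do.  Precisely, let the pairing of F(x)
    with the wave at (s, x) be Re (F(x)(s) exp (- i phase)).  Summing by parts
    along s over a grid of points x bounds the mean of this pairing by about
    L rho / sqrt d (lemma discrete_divergence).  Each single s therefore
    contributes less than half of eps / 2, the value of the pairing for F = f
    (lemma avg_test_upper).

    On the other side, the average over s of the pairing with the wave at a
    fixed x, rescaled by 2 rho / eps, is a 1-Lipschitz function of y on f(y),
    at all scales: the phases move by |<s, y' - z'>| / rho, and the mean over
    s of |<s, u>| is at most |u| (lemmas sum_norm_sign_dot and
    avg_test_encodeB).  It equals rho at y = x.  So if F is L-Lipschitz and
    within m of f on the net, then its value on F(x) is at least
    rho - O(L eps) - m, because some net point is within about eps of x.  The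
    hypothesis 6 L <= n^(1/4) says that L eps is a small part of rho.
    Comparing the two bounds gives m >= rho / 100.

    The space Y is R^(signs * bool) with the largest of the finitely many
    absolute values of linear forms which the argument has to control: the
    coordinates, the forms met in the summation by parts, and the averaged
    pairings (polyNormed).  A space with such a polyhedral norm is
    complete.

    The grid is a box with M = 100 n^2 points on each side, so that the part of
    it near the walls, where a step of the grid leaves the box, is negligible.
    It is lifted to the sphere by the inverse of y |-> y' around the pole;
    eps = 1 / (2 n M) makes it so small that the lift is 11/10-Lipschitz. *)

Set Implicit Arguments.
Unset Strict Implicit.
Unset Printing Implicit Defensive.

Local Open Scope classical_set_scope.
Local Open Scope ring_scope.

(** * Polyhedral norms on finite-dimensional spaces *)

Definition pairing (R : realType) (T : finType) (l w : T -> R) : R :=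
  \sum_t l t * w t.

(** The norm will be the maximum of the coordinates and of the linear forms with
    coefficients [ell j], in absolute value.  The coordinates are always
    included, so that every family ell defines a norm and not just a
    seminorm. *)
Definition polyNormed (R : realType) (T J : finType) (ell : J -> T -> R) : Type :=
  {ffun T -> R^o}.

Section PolyNormed.
Variables (R : realType) (T J : finType) (ell : J -> T -> R).
Local Notation V := (polyNormed ell).

HB.instance Definition _ := GRing.Lmodule.copy V {ffun T -> R^o}.

Definition eval_at (w : V) (t : T) : R := (w : {ffun T -> R^o}) t.

Lemma eval_atD (v w : V) t : eval_at (v + w) t = eval_at v t + eval_at w t.
Proof. by rewrite /eval_at ffunE. Qed.

Lemma eval_atZ a (w : V) t : eval_at (a *: w) t = a * eval_at w t.
Proof. by rewrite /eval_at ffunE. Qed.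

Lemma eval_atB (v w : V) t : eval_at (v - w) t = eval_at v t - eval_at w t.
Proof. by rewrite /eval_at !ffunE. Qed.

Definition functional (j : T + J) (w : V) : R :=
  match j with
  | inl t => eval_at w t
  | inr j => pairing (ell j) (eval_at w)
  end.

Lemma functionalD j (v w : V) :
  functional j (v + w) = functional j v + functional j w.
Proof.
case: j => [t|j] /=; first exact: eval_atD.
by rewrite /pairing -big_split; apply: eq_bigr => t _; rewrite eval_atD mulrDr.
Qed.

Lemma functionalZ j a (w : V) : functional j (a *: w) = a * functional j w.
Proof.
case: j => [t|j] /=; first exact: eval_atZ.
by rewrite /pairing mulr_sumr; apply: eq_bigr => t _; rewrite eval_atZ mulrCA.
Qed.

Lemma functionalB j (v w : V) :
  functional j (v - w) = functional j v - functional j w.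
Proof. by rewrite functionalD -scaleN1r functionalZ mulN1r. Qed.

Definition poly_norm (w : V) : R := \big[Num.max/0]_j `|functional j w|.

Lemma poly_normP (w : V) (b : R) : 0 <= b ->
  reflect (forall j, `|functional j w| <= b) (poly_norm w <= b).
Proof.
move=> b0; apply: (iffP idP) => [h j|h].
  by apply: le_trans h; exact: le_bigmax.
by apply: bigmax_le => // j _.
Qed.

Lemma functional_le_poly_norm j (w : V) : `|functional j w| <= poly_norm w.
Proof. exact: le_bigmax. Qed.

Lemma poly_norm_ge0 (w : V) : 0 <= poly_norm w.
Proof. by apply: bigmax_ge_id. Qed.

Lemma ler_poly_normD (v w : V) : poly_norm (v + w) <= poly_norm v + poly_norm w.
Proof.
apply/poly_normP => [|j]; first by rewrite addr_ge0 ?poly_norm_ge0.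
rewrite functionalD (le_trans (ler_normD _ _))//.
by rewrite lerD ?functional_le_poly_norm.
Qed.

Lemma poly_normZ (a : R) (w : V) : poly_norm (a *: w) = `|a| * poly_norm w.
Proof.
rewrite /poly_norm; elim/big_ind2 : _ => //; first by rewrite mulr0.
- by move=> x1 x2 y1 y2 -> ->; rewrite maxr_pMr.
- by move=> j _; rewrite functionalZ normrM.
Qed.

Lemma poly_norm0_eq0 (w : V) : poly_norm w = 0 -> w = 0.
Proof.
move=> w0; apply/ffunP => t; rewrite ffunE.
have := functional_le_poly_norm (inl t) w.
by rewrite w0 normr_le0 => /eqP.
Qed.

HB.instance Definition _ :=
  Lmodule_isNormed.Build R V ler_poly_normD poly_normZ poly_norm0_eq0.

Lemma polyNormedE (w : V) : `|w| = poly_norm w.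
Proof. by []. Qed.

(** Together with [functional_le_poly_norm] for the coordinates, this compares
    the norm with the sup norm; completeness then reduces to that of R. *)
Lemma poly_norm_le_coord : exists2 C : R, 0 < C &
  forall (w : V) b, (forall t, `|eval_at w t| <= b) -> 0 <= b -> `|w| <= C * b.
Proof.
(* 1 accounts for the coordinates, the sum for all the forms at once *)
exists (1 + \sum_j \sum_t `|ell j t|).
  by rewrite ltr_pwDl// sumr_ge0// => j _; rewrite sumr_ge0.
move=> w b wb b0; rewrite polyNormedE; apply/poly_normP => [|[t|j]].
- by rewrite mulr_ge0// addr_ge0// sumr_ge0// => j _; rewrite sumr_ge0.
- rewrite (le_trans (wb t))// mulrDl mul1r lerDl mulr_ge0// sumr_ge0// => j _.
  by rewrite sumr_ge0.
- apply: (le_trans (ler_norm_sum _ _ _)).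
  rewrite mulrDl mul1r ler_wpDl// (bigD1 j)//= mulrDl ler_wpDr//.
    by rewrite mulr_ge0// sumr_ge0// => i _; rewrite sumr_ge0.
  by rewrite mulr_suml ler_sum// => t _; rewrite normrM ler_wpM2l.
Qed.

Lemma polyNormed_complete (F : set_system V) :
  ProperFilter F -> cauchy F -> cvg F.
Proof.
move=> FF Fc.
have coordc t : cvg (eval_at ^~ t @ F).
  apply: cauchy_cvg; apply: cauchy_exP => e e0.
  have /cauchyP/(_ _ e0)[v Fv] := Fc.
  exists (eval_at v t); apply: (@filterS _ F _ (ball v e)) => // w.
  rewrite -!ball_normE /ball_ /= => vw.
  rewrite -eval_atB; exact: le_lt_trans (functional_le_poly_norm (inl t) _) vw.
pose l : V := [ffun t => lim (eval_at ^~ t @ F)].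
have [C C0 HC] := poly_norm_le_coord.
apply/cvg_ex; exists l; apply/cvgrPdist_le => e e0.
have : \forall w \near F, forall t, `|eval_at l t - eval_at w t| <= e / C.
  apply: filter_forall => t.
  have e1 : 0 < e / C by rewrite divr_gt0.
  have := coordc t; move=> /cvgrPdist_le /(_ _ e1).
  by rewrite [eval_at l t]/eval_at ffunE.
apply: filterS => w h.
have {}h t : `|eval_at (l - w) t| <= e / C by rewrite eval_atB.
rewrite (le_trans (HC _ _ h _))//; first by rewrite divr_ge0 ?ltW.
by rewrite mulrC divfK// gt_eqF.
Qed.

HB.instance Definition _ := Uniform_isComplete.Build V polyNormed_complete.

End PolyNormed.

(** * Euclidean norm and nets of the sphere *)

Section Euclid.
Variable R : realType.

Lemma sqr_l2norm n (x : 'rV[R]_n) : l2norm x ^+ 2 = \sum_i x 0 i ^+ 2.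
Proof. by rewrite /l2norm sqr_sqrtr// sumr_ge0// => i _; rewrite sqr_ge0. Qed.

Lemma l2norm_ge0 n (x : 'rV[R]_n) : 0 <= l2norm x.
Proof. exact: sqrtr_ge0. Qed.

Lemma l2norm_le n (x : 'rV[R]_n) b :
  0 <= b -> \sum_i x 0 i ^+ 2 <= b ^+ 2 -> l2norm x <= b.
Proof. by move=> b0 h; rewrite -ler_sqr ?nnegrE ?l2norm_ge0// sqr_l2norm. Qed.

Lemma l2norm_scale n (a : R) (x : 'rV[R]_n) : 0 <= a -> l2norm (a *: x) = a * l2norm x.
Proof.
move=> a0; rewrite /l2norm.
under eq_bigr do rewrite mxE exprMn.
by rewrite -mulr_sumr sqrtrM ?sqr_ge0// sqrtr_sqr ger0_norm.
Qed.

Lemma coord_le_l2norm n (x : 'rV[R]_n) i : `|x 0 i| <= l2norm x.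
Proof.
rewrite -ler_sqr ?nnegrE ?l2norm_ge0// sqr_l2norm real_normK ?num_real//.
by rewrite (bigD1 i)//= ler_wpDr// sumr_ge0// => j _; rewrite sqr_ge0.
Qed.

Lemma max_of_finite_code (T : Type) (I : finType) (code : T -> I) (N : set T)
    (u : T -> R) :
  (forall a b, N a -> N b -> code a = code b -> a = b) -> N !=set0 ->
  exists m, is_max [set u a | a in N] m.
Proof.
move=> codeI [a0 Na0].
(* g inverts the code on N, and takes the value a0 outside of code @` N *)
have /choice[g Hg] i :
    exists a, N a /\ ((exists2 b, N b & code b = i) -> code a = i).
  have [[b Nb bi]|no] := pselect (exists2 b, N b & code b = i); first by exists b.
  by exists a0; split.
case: (@Order.TotalTheory.arg_maxP _ R I (code a0) xpredT (fun i => u (g i)))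
  => // i _ imax.
exists (u (g i)); split; first by exists (g i) => //; case: (Hg i).
move=> _ [b Nb <-].
have [Ng Hc] := Hg (code b).
have -> : b = g (code b) by apply: codeI => //; rewrite Hc//; exists b.
exact: imax.
Qed.

(** A separated subset of the sphere is finite: cut the cube [-1, 1]^n into cells
    of side 1 / K with n / K < eps; each cell has at most one point of N. *)
Lemma max_on_net n (eps : R) (N : set 'rV[R]_n) (u : 'rV[R]_n -> R) :
  0 < eps -> N `<=` @unit_sphere R n -> separated_set (@l2dist R n) eps N ->
  N !=set0 -> exists m, is_max [set u a | a in N] m.
Proof.
move=> eps0 NS sep N0.
pose K := (Num.trunc (n%:R / eps)).+1.
have K0 : 0 < K%:R :> R by rewrite ltr0n.
pose cell (x : 'rV[R]_n) (i : 'I_n) := Num.trunc ((x 0 i + 1) * K%:R).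
have cell_lt x i : N x -> (cell x i < (2 * K).+1)%N.
  move=> /NS x1; rewrite ltnS -(ler_nat R) natrM.
  have /ler_normlP[h1 h2] : `|x 0 i| <= 1 by rewrite -[leRHS]x1 coord_le_l2norm.
  have x0 : 0 <= x 0 i + 1 by lra.
  have : (cell x i)%:R <= (x 0 i + 1) * K%:R by rewrite truncn_le mulr_ge0// ltW.
  by move/le_trans; apply; rewrite ler_wpM2r ?ler0n//; lra.
apply: (@max_of_finite_code _ {ffun 'I_n -> 'I_(2 * K).+1}
  (fun x => [ffun i => inord (cell x i)])) => // a b Na Nb.
move=> /ffunP ab; apply: contrapT => /(sep _ _ Na Nb).
apply/negP; rewrite -ltNge /l2dist.
have close i : `|a 0 i - b 0 i| <= K%:R^-1.
  have := congr1 val (ab i); rewrite !ffunE /= !inordK ?cell_lt// => cab.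
  have ge0 x : N x -> 0 <= (x 0 i + 1) * K%:R.
    move=> /NS x1; have /ler_normlP[h1 h2] : `|x 0 i| <= 1.
      by rewrite -[leRHS]x1 coord_le_l2norm.
    by rewrite mulr_ge0 ?ler0n//; lra.
  have /andP[a1 a2] := truncn_itv (ge0 _ Na).
  have /andP[b1 b2] := truncn_itv (ge0 _ Nb).
  rewrite -/(cell a i) in a1 a2; rewrite -/(cell b i) -cab in b1 b2.
  rewrite -(ler_pM2r K0) mulVf ?gt_eqF// -{1}(gtr0_norm K0) -normrM.
  by move: a2 b2; rewrite -natr1 ler_norml => a2 b2; apply/andP; split; lra.
have nK : n%:R / K%:R < eps.
  rewrite ltr_pdivrMr// mulrC -ltr_pdivrMr//.
  have n0 : 0 <= n%:R / eps by rewrite divr_ge0 ?ler0n ?(ltW eps0).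
  by have /andP[] := truncn_itv n0.
apply: le_lt_trans nK; apply: l2norm_le; first by rewrite divr_ge0.
apply: (@le_trans _ _ (\sum_(i < n) K%:R^-1 ^+ 2)).
  apply: ler_sum => i _; rewrite !mxE.
  by rewrite -real_normK ?num_real// ler_sqr ?nnegrE ?invr_ge0 ?(ltW K0) ?close.
rewrite sumr_const card_ord exprMn -[leLHS]mulr_natl.
rewrite ler_wpM2r ?sqr_ge0//.
by rewrite -natrX ler_nat; case: (n) => // m; rewrite leq_pmulr.
Qed.

(** The infimum that defines density need not be attained, whence r > eps. *)
Lemma net_point n (eps r : R) (N : set 'rV[R]_n) x :
  dense_subset (@l2dist R n) eps (@unit_sphere R n) N -> unit_sphere x ->
  eps < r -> exists2 a, N a & l2dist x a < r.
Proof.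
move=> dense x1 er.
have : (ereal_inf [set (l2dist x a)%:E | a in N] < r%:E)%E.
  by apply: le_lt_trans (dense _ x1) _; rewrite lte_fin.
by move=> /ereal_inf_lt[_ [a Na <-]]; rewrite lte_fin; exists a.
Qed.

End Euclid.

(** * A chart of the sphere around the pole *)

Section Chart.
Variable R : realType.

(** Lagrange's identity: the difference of the two sides is half the sum of the
    squares (u_i v_j - u_j v_i)^2. *)
Lemma cauchy_schwarz (I : finType) (u v : I -> R) :
  (\sum_i u i * v i) ^+ 2 <= (\sum_i u i ^+ 2) * (\sum_i v i ^+ 2).
Proof.
have : 0 <= \sum_i \sum_j (u i * v j - u j * v i) ^+ 2.
  by apply: sumr_ge0 => i _; apply: sumr_ge0 => j _; rewrite sqr_ge0.
have -> : \sum_i \sum_j (u i * v j - u j * v i) ^+ 2 =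
    (\sum_i u i ^+ 2) * (\sum_i v i ^+ 2) + (\sum_i v i ^+ 2) * (\sum_i u i ^+ 2)
    - 2 * ((\sum_i u i * v i) * (\sum_i u i * v i)).
  rewrite !big_distrlr mulr_sumr /= -big_split -sumrB; apply: eq_bigr => i _.
  rewrite mulr_sumr -big_split -sumrB; apply: eq_bigr => j _ /=.
  ring.
lra.
Qed.

Definition sphere_point d (x : 'rV[R]_d) : 'rV[R]_d.+1 :=
  \row_j if unlift ord0 j is Some i then x 0 i
         else Num.sqrt (1 - \sum_i x 0 i ^+ 2).

Lemma sphere_point0 d (x : 'rV[R]_d) :
  sphere_point x 0 ord0 = Num.sqrt (1 - l2norm x ^+ 2).
Proof. by rewrite mxE unlift_none sqr_l2norm. Qed.

Lemma sphere_point_lift d (x : 'rV[R]_d) i : sphere_point x 0 (lift ord0 i) = x 0 i.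
Proof. by rewrite mxE liftK. Qed.

Lemma col'_sphere_point d (x : 'rV[R]_d) : col' ord0 (sphere_point x) = x.
Proof. by apply/rowP => i; rewrite mxE sphere_point_lift. Qed.

Lemma sphere_pointP d (x : 'rV[R]_d) : l2norm x <= 1 -> unit_sphere (sphere_point x).
Proof.
move=> x1; rewrite /unit_sphere /= {1}/l2norm big_ord_recl sphere_point0.
under eq_bigr do rewrite sphere_point_lift.
by rewrite sqr_sqrtr ?subr_ge0 ?expr_le1 ?l2norm_ge0// -sqr_l2norm subrK sqrtr1.
Qed.

Lemma l2norm_col' d (y : 'rV[R]_d.+1) : l2norm (col' ord0 y) <= l2norm y.
Proof.
apply: l2norm_le; rewrite ?l2norm_ge0// sqr_l2norm big_ord_recl.
by under eq_bigr do rewrite mxE; rewrite lerDr sqr_ge0.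
Qed.

(** The first coordinates a and b of the two images satisfy
    a^2 - b^2 = |y|^2 - |x|^2 with a + b bounded below, so that (a - b)^2 is at
    most 2/19 of |x - y|^2, and 1 + 2/19 <= (11/10)^2. *)
Lemma sphere_point_lipschitz d (x y : 'rV[R]_d) :
  l2norm x ^+ 2 <= 20^-1 -> l2norm y ^+ 2 <= 20^-1 ->
  l2dist (sphere_point x) (sphere_point y) <= 11 / 10 * l2norm (x - y).
Proof.
move=> hx hy; apply: l2norm_le; first by rewrite mulr_ge0 ?l2norm_ge0//; lra.
rewrite big_ord_recl.
have coordB j : (sphere_point x - sphere_point y) 0 j =
    sphere_point x 0 j - sphere_point y 0 j by rewrite !mxE.
under eq_bigr do rewrite coordB 2!sphere_point_lift.
rewrite coordB 2!sphere_point0.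
have Exy : \sum_i (x 0 i - y 0 i) ^+ 2 = l2norm (x - y) ^+ 2.
  by rewrite sqr_l2norm; apply: eq_bigr => i _; rewrite !mxE.
have cs : (l2norm x ^+ 2 - l2norm y ^+ 2) ^+ 2 <= l2norm (x - y) ^+ 2 * (2 / 10).
  have -> : l2norm x ^+ 2 - l2norm y ^+ 2 =
      \sum_i (x 0 i - y 0 i) * (x 0 i + y 0 i).
    by rewrite !sqr_l2norm -sumrB; apply: eq_bigr => i _; ring.
  rewrite -Exy (le_trans (cauchy_schwarz _ _))// ler_wpM2l//.
    by rewrite sumr_ge0// => i _; rewrite sqr_ge0.
  apply: (@le_trans _ _ (2 * (l2norm x ^+ 2 + l2norm y ^+ 2))); last lra.
  rewrite !sqr_l2norm -big_split mulr_sumr ler_sum// => i _ /=.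
  by have := sqr_ge0 (x 0 i - y 0 i); nra.
rewrite Exy.
set a := Num.sqrt _; set b := Num.sqrt _.
have a2 : a ^+ 2 = 1 - l2norm x ^+ 2 by rewrite sqr_sqrtr//; lra.
have b2 : b ^+ 2 = 1 - l2norm y ^+ 2 by rewrite sqr_sqrtr//; lra.
have a0 : 0 <= a := sqrtr_ge0 _.
have b0 : 0 <= b := sqrtr_ge0 _.
have Eab : (l2norm x ^+ 2 - l2norm y ^+ 2) ^+ 2 = (a - b) ^+ 2 * (a + b) ^+ 2.
  have -> : l2norm x ^+ 2 = 1 - a ^+ 2 by lra.
  have -> : l2norm y ^+ 2 = 1 - b ^+ 2 by lra.
  ring.
have ab2 : 19 / 10 <= (a + b) ^+ 2.
  by have := mulr_ge0 a0 b0; nra.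
have : (a - b) ^+ 2 * (19 / 10) <= l2norm (x - y) ^+ 2 * (2 / 10).
  by rewrite (le_trans _ cs)// Eab ler_wpM2l ?sqr_ge0.
rewrite exprMn; have := sqr_ge0 (l2norm (x - y)); lra.
Qed.
End Chart.

(** * Sign vectors and the grid *)

Section Signs.
Variables (R : realType) (d : nat).
Local Notation signs := {ffun 'I_d -> bool}.

Definition sign_vec (s : signs) : 'rV[R]_d := \row_i (-1) ^+ s i.

Definition sign_dot (s : signs) (x : 'rV[R]_d) : R := \sum_i (-1) ^+ s i * x 0 i.

Lemma sign_dotB s x y : sign_dot s (x - y) = sign_dot s x - sign_dot s y.
Proof. by rewrite /sign_dot -sumrB; apply: eq_bigr => i _; rewrite !mxE mulrBr. Qed.

Lemma sign_dotD s x y : sign_dot s (x + y) = sign_dot s x + sign_dot s y.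
Proof. by rewrite /sign_dot -big_split; apply: eq_bigr => i _; rewrite !mxE mulrDr. Qed.

Lemma sign_dotZ s a x : sign_dot s (a *: x) = a * sign_dot s x.
Proof. by rewrite /sign_dot mulr_sumr; apply: eq_bigr => i _; rewrite !mxE mulrCA. Qed.

Lemma sign_dot_sign_vec s : sign_dot s (sign_vec s) = d%:R.
Proof.
rewrite /sign_dot (eq_bigr (fun=> 1)) ?sumr_const ?card_ord// => i _.
by rewrite mxE -expr2 sqrr_sign.
Qed.

Lemma l2norm_sign_vec s : l2norm (sign_vec s) = Num.sqrt d%:R.
Proof.
congr Num.sqrt; rewrite (eq_bigr (fun=> 1)) ?sumr_const ?card_ord// => i _.
by rewrite mxE sqrr_sign.
Qed.

(** The signs are orthonormal: for i <> j, flipping the sign at i exchanges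
    opposite terms. *)
Lemma sum_sign_mul (i j : 'I_d) :
  \sum_(s : signs) (-1) ^+ s i * (-1) ^+ s j = (#|{: signs}| * (i == j))%:R :> R.
Proof.
have [->|ij] := eqVneq i j.
  rewrite muln1 (eq_bigr (fun=> 1)) ?sumr_const// => s _.
  by rewrite -expr2 sqrr_sign.
pose flip (s : signs) : signs := [ffun l => (l == i) (+) s l].
have flipK : involutive flip.
  by move=> s; apply/ffunP => l; rewrite !ffunE addKb.
rewrite muln0; apply/eqP; rewrite -[_ == _](mulrn_eq0 _ 2) mulr2n.
rewrite [X in X + _](reindex_inj (inv_inj flipK)) -big_split big1//= => s _.
by rewrite !ffunE eqxx eq_sym (negPf ij) /= signrN mulNr addNr.
Qed.

Lemma sum_sqr_sign_dot (x : 'rV[R]_d) :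
  \sum_(s : signs) sign_dot s x ^+ 2 = #|{: signs}|%:R * l2norm x ^+ 2.
Proof.
under eq_bigr do rewrite /sign_dot expr2 big_distrlr.
rewrite exchange_big sqr_l2norm mulr_sumr; apply: eq_bigr => i _.
rewrite exchange_big (bigD1 i)//= [X in _ + X]big1 => [|j ji].
   have := sum_sign_mul i i; rewrite eqxx muln1 => <-.
  by rewrite addr0 mulr_suml; apply: eq_bigr => s _; rewrite mulrACA expr2.
under eq_bigr do rewrite mulrACA.
by rewrite -mulr_suml sum_sign_mul eq_sym (negPf ji) muln0 mul0r.
Qed.

(** The mean of |<s, x>| over s is at most its quadratic mean, which is |x|.  This
    is the gain of a factor sqrt d over the bound |s| |x| for each s: the average
    over s of the waves is much smoother than each of them. *)
Lemma sum_norm_sign_dot (x : 'rV[R]_d) :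
  \sum_(s : signs) `|sign_dot s x| <= #|{: signs}|%:R * l2norm x.
Proof.
rewrite -ler_sqr ?nnegrE ?mulr_ge0 ?l2norm_ge0 ?ler0n ?sumr_ge0//.
have := cauchy_schwarz (fun=> 1) (fun s : signs => `|sign_dot s x|).
under eq_bigr do rewrite mul1r.
move=> /le_trans; apply.
under [X in _ * X]eq_bigr do rewrite real_normK ?num_real//.
rewrite sum_sqr_sign_dot (eq_bigr (fun=> 1)) ?sumr_const; last first.
  by move=> s _; rewrite expr1n.
by rewrite mulrA -expr2 exprMn.
Qed.

End Signs.

Section Grid.
Variables (R : realType) (d M : nat).
Local Notation signs := {ffun 'I_d -> bool}.
Local Notation grid := {ffun 'I_d -> 'I_M}.

Definition grid_point (g : R) (k : grid) : 'rV[R]_d := \row_i (g * (k i)%:R).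

(** Translation by the sign vector s, cyclic in each coordinate so that it is a
    bijection of the grid. *)
Definition grid_shift (s : signs) (k : grid) : grid :=
  [ffun i => if s i then ord_pred (k i) else ordS (k i)].

Definition grid_unshift (s : signs) (k : grid) : grid :=
  [ffun i => if s i then ordS (k i) else ord_pred (k i)].

Lemma grid_shift_bij s : bijective (grid_shift s).
Proof.
exists (grid_unshift s) => k; apply/ffunP => i; rewrite !ffunE.
  by case: (s i); rewrite ?ord_predK ?ordSK.
by case: (s i); rewrite ?ord_predK ?ordSK.
Qed.

Definition wraps (s : signs) (k : grid) : bool :=
  [exists i, if s i then k i == 0%N :> nat else (k i).+1 == M].

Lemma grid_point_shift g s k : ~~ wraps s k ->
  grid_point g (grid_shift s k) = grid_point g k + g *: sign_vec R s.
Proof.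
move=> /existsPn nw; apply/rowP => i; rewrite !mxE ffunE.
have kM := ltn_ord (k i); have := nw i.
case: (s i) => /= kiN; rewrite ?expr0 ?expr1.
  have k0 : (0 < k i)%N by rewrite lt0n.
  have -> : ((k i + M).-1 %% M)%N = (k i).-1.
    by rewrite -(prednK k0) addSn /= modnDr modn_small// (leq_trans _ kM)// ltnS leq_pred.
  by rewrite -{2}(prednK k0) -natr1; ring.
rewrite modn_small; last by rewrite ltn_neqAle kiN.
by rewrite -natr1; ring.
Qed.

(** Changing the coordinate i of k gives M points of the grid for each k in the
    slice, all distinct. *)
Lemma card_coord_eq (i : 'I_d) (c : 'I_M) :
  (#|[set k : grid | k i == c]%SET| * M <= #|{: grid}|)%N.
Proof.
pose upd (p : grid * 'I_M) : grid := [ffun j => if j == i then p.2 else p.1 j].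
rewrite -[X in (_ * X)%N]card_ord -cardsT -cardsX.
rewrite -(@card_in_imset _ _ upd); first exact: max_card.
move=> [k a] [l b] /=; rewrite !inE /= !andbT => /eqP ki /eqP li /ffunP kl.
congr pair; last by have := kl i; rewrite !ffunE eqxx.
apply/ffunP => j; have := kl j; rewrite !ffunE /=.
by have [->|] := eqVneq j i; rewrite ?ki ?li.
Qed.

(** A point wraps only if it lies on one of d faces of the box. *)
Lemma card_wraps s : (#|[set k | wraps s k]%SET| * M <= d * #|{: grid}|)%N.
Proof.
have [M0|M0] := posnP M; first by rewrite [X in (_ * X <= _)%N]M0 muln0.
have last_lt : (M.-1 < M)%N by rewrite prednK.
pose bad i : 'I_M := if s i then Ordinal M0 else Ordinal last_lt.
have sub : [set k | wraps s k]%SET \subset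
    (\bigcup_i [set k : grid | k i == bad i])%SET.
  apply/fintype.subsetP => k; rewrite inE => /existsP[i ki].
  apply/bigcupP; exists i => //; rewrite inE -val_eqE /bad.
  by move: ki; case: (s i) => //= /eqP kM; rewrite -[in M.-1]kM.
apply: (@leq_trans (\sum_i #|[set k : grid | k i == bad i]%SET| * M)).
  rewrite -big_distrl leq_mul2r /= (leq_trans (subset_leq_card sub)) ?orbT//.
  elim/big_rec2 : _ => [|i m S _ h]; first by rewrite cards0.
  by apply: leq_trans (leq_card_setU _ _) _; rewrite leq_add2l.
rewrite (leq_trans (leq_sum _ (fun i _ => card_coord_eq i (bad i))))//.
by rewrite sum_nat_const card_ord.
Qed.

Lemma l2norm_grid_point (g : R) (k : grid) :
  l2norm (grid_point g k) ^+ 2 <= d%:R * (g * M%:R) ^+ 2.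
Proof.
rewrite sqr_l2norm -[X in X%:R * _]card_ord mulr_natl -sumr_const.
apply: ler_sum => i _; rewrite mxE !exprMn ler_wpM2l ?sqr_ge0// ler_sqr ?nnegrE ?ler0n//.
by rewrite ler_nat ltnW.
Qed.

End Grid.

(** * Waves and summation by parts *)

Section Trig.
Variable R : realType.

(** Complex numbers are written as functions of a boolean, real part at [false]:
    [wave t] is exp (i t), [dwave t] is its derivative i exp (i t), and [inner]
    is the real inner product of the plane. *)
Definition wave (t : R) (b : bool) : R := if b then sin t else cos t.

Definition dwave (t : R) (b : bool) : R := if b then cos t else - sin t.

Definition inner (p q : bool -> R) : R := p false * q false + p true * q true.

(** From 0 > cos 2 = 1 - 2 sin^2 1. *)
Lemma sin1_ge : 7 / 10 <= sin 1 :> R.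
Proof.
have s0 : 0 <= sin 1 :> R by rewrite ltW// sin2_gt0//; apply/andP; split; lra.
have := cos2_lt0 R; rewrite -[2%:R]/(1 *+ 2) cos_mulr2n cos2sin2 => c.
by rewrite -ler_sqr ?nnegrE//; lra.
Qed.

Lemma cos_lipschitz (a b : R) : `|cos a - cos b| <= `|a - b|.
Proof.
wlog ab : a b / a <= b => [hw|].
  by case/orP : (le_total a b) => /hw //; rewrite distrC [leRHS]distrC.
have dcos (x : R) : is_derive x (1 : R) cos (- sin x) by exact: is_derive_cos.
have ccos : {within `[a, b], continuous (@cos R)}.
  by apply: continuous_subspaceT; exact: continuous_cos.
have [c _ E] := MVT_segment ab (fun x _ => dcos x) ccos.
rewrite distrC E distrC normrM normrN -[leRHS]mul1r ler_wpM2r ?sin_max//.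
Qed.

Lemma inner_wave (s t : R) : inner (wave s) (wave t) = cos (s - t).
Proof. by rewrite /inner /= cosB. Qed.

Lemma inner_dwave (s t : R) : inner (dwave s) (wave t) = sin (t - s).
Proof. by rewrite /inner /= sinB; ring. Qed.

(** Summation by parts: if sigma advances the phase theta by 2 eta, then the sum of
    the pairings of w with the wave is controlled by the variation of w along
    sigma, because
    dwave (t - eta) - dwave (t + eta) = 2 sin eta * wave t.
    At the exceptional points, where sigma does not advance the phase, only the
    bound B on w is used. *)
Lemma discrete_divergence (Q : finType) (sigma : Q -> Q) (wrap : pred Q)
    (theta : Q -> R) (w : Q -> bool -> R) (eta A B : R) :
  bijective sigma -> 0 <= A ->
  (forall k, ~~ wrap k -> theta (sigma k) = theta k + eta *+ 2) ->
  (forall k, ~~ wrap k ->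
    `|inner (dwave (theta k + eta)) (w (sigma k) - w k)| <= A) ->
  (forall k b, `|w k b| <= B) ->
  2 * sin eta * \sum_k inner (wave (theta k)) (w k) <=
  #|Q|%:R * A + #|[set k | wrap k]%SET|%:R * (4 * B).
Proof.
move=> bij A0 step var bnd.
have wB t k : `|inner (dwave t) (w k)| <= 2 * B.
  rewrite (le_trans (ler_normD _ _))// !normrM mulr2n mulrDl !mul1r.
  have B0 : 0 <= B by apply: le_trans (bnd k true).
  by rewrite lerD// -[leRHS]mul1r ler_pM// ?bnd//= ?normrN ?sin_max ?cos_max.
have -> : 2 * sin eta * \sum_k inner (wave (theta k)) (w k) =
    \sum_k (inner (dwave (theta (sigma k) - eta)) (w (sigma k)) -
            inner (dwave (theta k + eta)) (w k)).
  have reidx : \sum_k inner (dwave (theta (sigma k) - eta)) (w (sigma k)) =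
      \sum_k inner (dwave (theta k - eta)) (w k).
    by rewrite [RHS](reindex sigma)//; exact: onW_bij.
  rewrite sumrB reidx -sumrB mulr_sumr; apply: eq_bigr => k _.
  by rewrite /inner /= !sinD !cosD !sinN !cosN; ring.
rewrite -!sum1_card !natr_sum !mulr_suml [X in _ + X]big_mkcond -big_split /=.
apply: ler_sum => k _; rewrite inE mul1r.
case: ifPn => [_|nw].
  rewrite (le_trans (ler_norm _))// (le_trans (ler_normB _ _))// mul1r.
  by rewrite ler_wpDl// (le_trans (lerD (wB _ _) (wB _ _)))//; lra.
rewrite addr0 step// (le_trans _ (var _ nw))// (le_trans _ (ler_norm _))//.
rewrite (_ : theta k + eta *+ 2 - eta = theta k + eta); last by ring.
rewrite /inner [X in _ <= _ * X + _](_ : _ = w (sigma k) false - w k false)//.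
rewrite [X in _ <= _ + _ * X](_ : _ = w (sigma k) true - w k true)//.
by lra.
Qed.

End Trig.

(** * The target space and the map on the net *)

Section Target.
Variables (R : realType) (d M : nat) (eps rho : R).
Hypotheses (eps_gt0 : 0 < eps) (rho_gt0 : 0 < rho).
Hypotheses (d_gt0 : (0 < d)%N) (M_gt0 : (0 < M)%N).
Local Notation signs := {ffun 'I_d -> bool}.
Local Notation grid := {ffun 'I_d -> 'I_M}.
Local Notation S := (#|{: signs}|%:R : R).

Definition phase (s : signs) (x : 'rV[R]_d) : R := sign_dot s x / rho.

(** With this mesh, a grid step in the direction s changes the phase by exactly 2. *)
Definition mesh : R := rho * 2 / d%:R.

Local Notation X := (@grid_point R d M mesh).

(** The forms of the first kind are those to which the variation of a map is
    applied in [discrete_divergence], with eta = 1.  Those of the second kind are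
    the averages over s of the pairings with the wave at a grid point, scaled to
    take the value rho on the image of that point. *)
Definition test_vec (j : signs * grid + grid) (t : signs * bool) : R :=
  match j with
  | inl (s, k) => if t.1 == s then dwave (phase s (X k) + 1) t.2 else 0
  | inr k => rho / (eps / 2) / S * wave (phase t.1 (X k)) t.2
  end.

Local Notation target := (polyNormed test_vec).

Definition encode (y : 'rV[R]_d.+1) : target :=
  [ffun t => eps / 2 * wave (phase t.1 (col' ord0 y)) t.2].

Definition component (w : target) (s : signs) (b : bool) : R := eval_at w (s, b).

Definition avg_test (k : grid) (w : target) : R := functional (inr (inr k)) w.

Lemma S_gt0 : 0 < S.
Proof. by rewrite ltr0n; apply/card_gt0P; exists [ffun=> true]. Qed.

Lemma rhoS_ge0 : 0 <= rho / S.
Proof. by rewrite divr_ge0 ?(ltW rho_gt0) ?(ltW S_gt0). Qed.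

Lemma sum_signs_bool (G : signs * bool -> R) :
  \sum_t G t = \sum_s (G (s, false) + G (s, true)).
Proof.
transitivity (\sum_t G (t.1, t.2)); first by apply: eq_bigr => -[].
rewrite -(pair_bigA _ (fun s b => G (s, b))); apply: eq_bigr => s _.
by rewrite big_bool addrC.
Qed.

Lemma functional_dwaveE s k (w : target) :
  functional (inr (inl (s, k))) w = inner (dwave (phase s (X k) + 1)) (component w s).
Proof.
rewrite /= /pairing sum_signs_bool (bigD1 s)//= eqxx [X in _ + X]big1 ?addr0//.
by move=> r /negPf rs; rewrite rs !mul0r addr0.
Qed.

Lemma avg_testE k (w : target) :
  avg_test k w =
  rho / (eps / 2) / S * \sum_s inner (wave (phase s (X k))) (component w s).
Proof.
rewrite /avg_test /= /pairing sum_signs_bool mulr_sumr.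
by apply: eq_bigr => s _; rewrite /inner -!mulrA -!mulrDr.
Qed.

Lemma avg_testB_le k (v w : target) : `|avg_test k v - avg_test k w| <= `|v - w|.
Proof. by rewrite /avg_test -functionalB functional_le_poly_norm. Qed.

Lemma component_encode y s b :
  component (encode y) s b = eps / 2 * wave (phase s (col' ord0 y)) b.
Proof. by rewrite /component /eval_at /encode ffunE. Qed.

Lemma inner_component_encode p y s :
  inner p (component (encode y) s) = eps / 2 * inner p (wave (phase s (col' ord0 y))).
Proof. by rewrite /inner !component_encode; ring. Qed.

Lemma avg_test_encode k y :
  avg_test k (encode y) =
  rho / S * \sum_s cos (phase s (X k) - phase s (col' ord0 y)).
Proof.
rewrite avg_testE !mulr_sumr; apply: eq_bigr => s _.
rewrite inner_component_encode inner_wave; field.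
by rewrite !gt_eqF ?S_gt0.
Qed.

Lemma phaseB s x y : phase s x - phase s y = phase s (x - y).
Proof. by rewrite /phase sign_dotB mulrBl. Qed.

(** The mean over s compensates for the steepness of each wave
    ([sum_norm_sign_dot]).  The bound is valid at distances below eps, as needed to
    compare a grid point with a net point close to it. *)
Lemma avg_test_encodeB k y z :
  `|avg_test k (encode y) - avg_test k (encode z)| <= l2dist y z.
Proof.
rewrite !avg_test_encode -mulrBr -sumrB normrM gtr0_norm ?divr_gt0 ?S_gt0//.
apply: (@le_trans _ _ (rho / S * (\sum_s `|sign_dot s (col' ord0 (z - y))| / rho))).
  rewrite ler_wpM2l ?rhoS_ge0//.
  rewrite (le_trans (ler_norm_sum _ _ _))// ler_sum// => s _.
  rewrite (le_trans (cos_lipschitz _ _))//.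
  rewrite [X in `|X|](_ : _ = phase s (col' ord0 z) - phase s (col' ord0 y)).
    rewrite phaseB /phase normrM [`|rho^-1|]gtr0_norm ?invr_gt0//.
    by rewrite [col' _ z - _](_ : _ = col' ord0 (z - y))//; apply/rowP => i; rewrite !mxE.
  by ring.
rewrite -mulr_suml mulrCA mulrA [X in X <= _](_ : _ =
    (\sum_s `|sign_dot s (col' ord0 (z - y))|) / S); last first.
  by field; rewrite !gt_eqF ?S_gt0.
rewrite ler_pdivrMr ?S_gt0// mulrC (le_trans (sum_norm_sign_dot _))//.
rewrite ler_wpM2l ?ler0n// (le_trans (l2norm_col' _))// /l2dist /l2norm.
rewrite le_eqVlt; apply/orP; left; apply/eqP; congr Num.sqrt.
by apply: eq_bigr => i _; rewrite !mxE; ring.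
Qed.

(** These forms see a single wave, of amplitude eps / 2.  This is why its steepness
    costs nothing on an eps-separated set. *)
Lemma osc_encode j y : (forall k, j <> inr (inr k)) ->
  `|functional j (encode y : target)| <= eps / 2.
Proof.
have e2 : 0 <= eps / 2 by rewrite ltW ?divr_gt0.
case: j => [[s b] _|[[s k] _|k /(_ k)//]].
  rewrite [functional _ _](component_encode y s b) normrM ger0_norm//.
  by rewrite ler_piMr//; case: b; rewrite ?sin_max ?cos_max.
rewrite functional_dwaveE inner_component_encode inner_dwave normrM ger0_norm//.
by rewrite ler_piMr// sin_max.
Qed.

Lemma encode_lipschitz (N : set 'rV[R]_d.+1) :
  separated_set (@l2dist R d.+1) eps N -> l2_lipschitz 1 N encode.
Proof.
move=> sep y z Ny Nz; rewrite mul1r.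
have [->|yz] := pselect (y = z); first by rewrite subrr normr0 l2norm_ge0.
rewrite polyNormedE; apply/poly_normP => [|j]; first exact: l2norm_ge0.
rewrite functionalB.
have [[k ->]|nk] := pselect (exists k, j = inr (inr k)); first exact: avg_test_encodeB.
have {}nk k : j <> inr (inr k) by move=> jk; apply: nk; exists k.
apply: le_trans (sep _ _ Ny Nz yz); apply: le_trans (ler_normB _ _) _.
by have := osc_encode y nk; have := osc_encode z nk; lra.
Qed.

Lemma norm_encode y : `|encode y| <= rho + eps.
Proof.
have re : 0 <= rho + eps by rewrite ltW ?addr_gt0.
rewrite polyNormedE; apply/poly_normP => // j.
have [[k ->]|nk] := pselect (exists k, j = inr (inr k)); last first.
  have {}nk k : j <> inr (inr k) by move=> jk; apply: nk; exists k.
  by apply: le_trans (osc_encode y nk) _; have := rho_gt0; have := eps_gt0; lra.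
rewrite -/(avg_test k _) avg_test_encode normrM gtr0_norm ?divr_gt0 ?S_gt0//.
apply: (@le_trans _ _ (rho / S * S)); last by rewrite divfK ?gt_eqF ?S_gt0// lerDl ltW.
rewrite ler_wpM2l ?rhoS_ge0//.
rewrite (le_trans (ler_norm_sum _ _ _))// -sum1_card natr_sum ler_sum// => s _.
exact: cos_max.
Qed.

Lemma avg_test_grid k : avg_test k (encode (sphere_point (X k))) = rho.
Proof.
rewrite avg_test_encode col'_sphere_point.
under eq_bigr do rewrite subrr cos0.
by rewrite sumr_const divfK// gt_eqF ?S_gt0.
Qed.

Lemma phase_shift s k : ~~ wraps s k ->
  phase s (X (grid_shift s k)) = phase s (X k) + 1 *+ 2.
Proof.
move=> nw; rewrite /phase grid_point_shift// sign_dotD sign_dotZ sign_dot_sign_vec.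
by rewrite /mesh; field; rewrite gt_eqF //= pnatr_eq0 -lt0n.
Qed.

(** Exchange the means over the grid and over s: for a fixed s, the sum over the
    grid is bounded by [discrete_divergence].  The term in B comes from the points
    that wrap, a proportion of at most d / M. *)
Lemma avg_test_upper (W : grid -> target) (lo A B : R) :
  0 <= A ->
  (forall k, lo <= avg_test k (W k)) ->
  (forall s k, ~~ wraps s k -> `|W (grid_shift s k) - W k| <= A) ->
  (forall k, `|W k| <= B) ->
  lo <= rho / (eps / 2) * (5 / 7) * (A + 4 * B * d%:R / M%:R).
Proof.
move=> A0 lower var bnd.
have M0 : 0 < M%:R :> R by rewrite ltr0n.
have Q0 : 0 < #|{: grid}|%:R :> R.
  by rewrite ltr0n; apply/card_gt0P; exists [ffun=> Ordinal M_gt0].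
have B0 : 0 <= B := le_trans (normr_ge0 _) (bnd [ffun=> Ordinal M_gt0]).
have re : 0 < rho / (eps / 2) by rewrite !divr_gt0.
set U := A + _.
have perS s : \sum_k inner (wave (phase s (X k))) (component (W k) s) <=
    5 / 7 * (#|{: grid}|%:R * U).
  have wrapB : #|[set k : grid | wraps s k]%SET|%:R * (4 * B) <=
      #|{: grid}|%:R * (4 * B * d%:R / M%:R).
    have := @card_wraps d M s; rewrite -(ler_nat R) !natrM => cw.
    have B4 : 0 <= 4 * B by rewrite mulr_ge0.
    have := ler_wpM2r B4 cw => cwB.
    rewrite [leRHS](_ : _ = #|{: grid}|%:R * (4 * B) * d%:R / M%:R); last by rewrite !mulrA.
    by rewrite ler_pdivlMr//; lra.
  (* 7/5 <= 2 sin 1, whence the factor 5/7 *)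
  have := @discrete_divergence R _ (@grid_shift d M s) (@wraps d M s) (fun k => phase s (X k))
    (fun k => component (W k) s) 1 A B (@grid_shift_bij d M s) A0 (@phase_shift s).
  set Z := \sum_k _ => HZ.
  have {}HZ : 2 * sin 1 * Z <= #|{: grid}|%:R * U.
    rewrite /U mulrDr (le_trans (HZ _ _))//; last by rewrite lerD2l.
      move=> k nw; apply: le_trans (var s k nw); rewrite polyNormedE.
      apply: le_trans (functional_le_poly_norm (inr (inl (s, k))) _).
      by rewrite functional_dwaveE /inner /component !eval_atB.
    move=> k b; apply: le_trans (bnd k).
    exact: (functional_le_poly_norm (inl (s, b))).
  have [Z0|Z0] := leP Z 0.
    by rewrite (le_trans Z0)// mulr_ge0// mulr_ge0 ?ler0n// addr_ge0// divr_ge0// !mulr_ge0.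
  have := sin1_ge R; nra.
have : \sum_(k : grid) lo <= \sum_k avg_test k (W k) by apply: ler_sum => k _.
under [leRHS]eq_bigr do rewrite avg_testE.
rewrite -mulr_sumr exchange_big /= sumr_const -[leLHS]mulr_natl => h.
rewrite -(ler_pM2l Q0) (le_trans h)//.
apply: (@le_trans _ _ (rho / (eps / 2) / S * \sum_(s : signs) (5 / 7 * (#|{: grid}|%:R * U)))).
  by rewrite ler_wpM2l ?ler_sum// divr_ge0 ?(ltW re) ?(ltW S_gt0).
rewrite sumr_const -[X in _ * X <= _]mulr_natl le_eqVlt; apply/orP; left; apply/eqP.
by field; rewrite !gt_eqF ?S_gt0.
Qed.

End Target.

(** * The lower bound *)

Lemma dimension_bound (R : realType) (n : nat) (L : R) :
  1 <= L -> 6 * L <= n%:R `^ 4^-1 ->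
  [/\ (1296 <= n)%N & 36 * L ^+ 2 <= Num.sqrt n%:R].
Proof.
move=> L1 hL.
have h0 : 0 <= 6 * L by lra.
have n4 : (n%:R `^ 4^-1) ^+ 4 = n%:R :> R.
  by rewrite -powR_mulrn ?powR_ge0// -powRrM mulVf ?powRr1 ?ler0n.
have Ln : (6 * L) ^+ 4 <= n%:R.
  by rewrite -n4 lerXn2r ?nnegrE ?powR_ge0.
split.
  rewrite -(ler_nat R) (le_trans _ Ln)//.
  rewrite (_ : 1296%:R = 6 ^+ 4); last by rewrite -natrX.
  by rewrite lerXn2r ?nnegrE//; lra.
have L36 : 0 <= 36 * L ^+ 2 by rewrite mulr_ge0 ?sqr_ge0.
rewrite -ler_sqr ?nnegrE ?sqrtr_ge0// sqr_sqrtr ?ler0n//.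
by rewrite (le_trans _ Ln)// le_eqVlt; apply/orP; left; apply/eqP; ring.
Qed.

Theorem theorem4 (R : realType) :
  exists2 c : R, 0 < c &
  forall (n : nat) (L : R),
    1 <= L -> 6 * L <= n%:R `^ 4^-1 ->
  exists2 eps : R, 0 < eps &
  forall N : set 'rV[R]_n,
    eps_net (@l2dist R n) eps (@unit_sphere R n) N ->
  exists (Y : completeNormedModType R) (f : 'rV[R]_n -> Y),
    l2_lipschitz 1 N f /\
    forall F : 'rV[R]_n -> Y,
      l2_lipschitz L (@unit_sphere R n) F ->
      exists2 m : R,
        is_max [set `|F a - f a| | a in N] m &
        c * (Num.sqrt n%:R / L) * eps <= m.
Proof.
(* with this constant, the bound to be proved is rho / 100 *)
exists 700^-1 => // n L L1 hL.
have [n1296 sqL] := dimension_bound L1 hL.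
case: n n1296 {hL} sqL => // d n1296 sqL.
have d1 : (0 < d)%N by rewrite -ltnS (leq_trans _ n1296).
set n : R := d.+1%:R; set a := Num.sqrt n.
pose M := (100 * d.+1 * d.+1)%N.
have M0 : (0 < M)%N by [].
have MR0 : 0 < M%:R :> R by rewrite ltr0n.
have n0 : 0 < n by rewrite ltr0n.
have a0 : 0 < a by rewrite sqrtr_gt0.
have a2 : a ^+ 2 = n by rewrite sqr_sqrtr// ltW.
have L0 : 0 < L by lra.
pose eps : R := (2 * n * M%:R)^-1.
have eps0 : 0 < eps by rewrite invr_gt0 !mulr_gt0.
exists eps => // N [NS sep dense].
(* this rho balances the two errors: the relative error 2.2 L eps / rho made in
   passing to the net against the relative size L rho / (eps sqrt n) of the
   averaged tests of an L-Lipschitz map *)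
pose rho := a * eps / (7 * L).
have rho0 : 0 < rho by rewrite divr_gt0 ?mulr_gt0.
pose Y := polyNormed (@test_vec R d M eps rho).
pose f : 'rV[R]_d.+1 -> Y := @encode R d M eps rho.
exists Y, f; split.
  exact: encode_lipschitz.
move=> F FL.
have d0 : 0 < d%:R :> R by rewrite ltr0n.
have nd : n = d%:R + 1 by rewrite /n -natr1.
pose g := mesh d rho.
have g0 : 0 < g by apply: divr_gt0 => //; apply: mulr_gt0.
pose x (k : {ffun 'I_d -> 'I_M}) := grid_point g k.
have a_le_n : a <= n.
  rewrite -ler_sqr ?nnegrE ?(ltW a0) ?(ltW n0)// a2 ler_eXnr//.
  by rewrite ler1n.
have rhoL : rho * (7 * L) = a * eps by rewrite /rho divfK// gt_eqF// mulr_gt0.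
have MRE : M%:R = 100 * n * n :> R by rewrite /M !natrM.
have epsE : eps * (2 * n * M%:R) = 1 by rewrite mulVf// gt_eqF// !mulr_gt0.
have rhoM : rho * M%:R <= 14^-1.
  have h1 : 7 * rho <= n * eps.
    apply: (@le_trans _ _ (rho * (7 * L))).
      by rewrite mulrC ler_wpM2l ?(ltW rho0)//; lra.
    by rewrite rhoL ler_wpM2r ?(ltW eps0).
  have := ler_wpM2r (ltW MR0) h1; lra.
have x_small k : l2norm (x k) ^+ 2 <= 20^-1.
  apply: le_trans (l2norm_grid_point _ _) _.
  have -> : d%:R * (g * M%:R) ^+ 2 = 4 * (rho * M%:R) ^+ 2 / d%:R.
    by rewrite /g /mesh; field; rewrite gt_eqF.
  rewrite ler_pdivrMr//.
  have d1R : 1 <= d%:R :> R by rewrite ler1n.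
  have q0 : 0 <= rho * M%:R by rewrite mulr_ge0// ltW.
  have q2 : (rho * M%:R) ^+ 2 <= 14^-1 ^+ 2 by rewrite ler_sqr ?nnegrE.
  by move: q2 d1R; set q := (_ * _) ^+ 2; lra.
have xS k : unit_sphere (sphere_point (x k)).
  apply: sphere_pointP; rewrite -(@expr_le1 _ 2) ?l2norm_ge0//.
  by apply: le_trans (x_small k) _; lra.
have eps11 : eps < 11 / 10 * eps by lra.
have [a1 Na1 _] := net_point dense (xS [ffun=> Ordinal M0]) eps11.
have [m mmax] : exists m, is_max [set `|F a - f a| | a in N] m.
  by apply: (max_on_net (eps := eps)) => //; exists a1.
exists m => //; rewrite leNgt; apply/negP => m_small.
have {}m_small : m < rho / 100.
  rewrite (lt_le_trans m_small)// /rho -/n -/a le_eqVlt; apply/orP; left.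
  by apply/eqP; field; rewrite gt_eqF.
have m_bound b : N b -> `|F b - f b| <= m by move=> Nb; apply: mmax.2; exists b.
pose test := @avg_test R d M eps rho.
pose W k : Y := F (sphere_point (x k)).
have eL : L * eps <= 7 / 36 * rho.
  rewrite -(ler_pM2l L0).
  have := ler_wpM2r (ltW eps0) sqL; rewrite -/n -/a; lra.
have epsL : eps <= L * eps by rewrite ler_peMl ?(ltW eps0).
have near k : exists2 b, N b & l2dist (sphere_point (x k)) b <= 11 / 10 * eps.
  have [b Nb xb] := net_point dense (xS k) eps11.
  by exists b => //; exact: ltW.
have Wf k : exists2 b, l2dist (sphere_point (x k)) b <= 11 / 10 * eps &
    `|W k - f b| <= L * (11 / 10 * eps) + m.
  have [b Nb xb] := near k; exists b => //.
  rewrite -(subrK (F b) (W k)) -addrA (le_trans (ler_normD _ _))// lerD ?m_bound//.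
  by rewrite (le_trans (FL _ _ (xS k) (NS _ Nb)))// ler_wpM2l// ltW.
(* rho - 1.1 (L + 1) eps - m, where L eps <= 7/36 rho *)
have lower k : 56 / 100 * rho <= test k (W k).
  have [b xb Wb] := Wf k.
  have h1 := avg_test_encodeB eps0 rho0 k (sphere_point (x k)) b.
  rewrite avg_test_grid// -/f -/test in h1.
  have h2 : `|test k (W k) - test k (f b)| <= `|W k - f b|.
    exact: avg_testB_le.
  have {h1}/ler_normlP[_ h1] := le_trans h1 xb.
  have {h2}/ler_normlP[h2 _] := le_trans h2 Wb.
  lra.
have normW k : `|W k| <= 3 / 2 * rho.
  have [b _ Wb] := Wf k.
  rewrite -(subrK (f b) (W k)) (le_trans (ler_normD _ _))//.
  have := norm_encode M eps0 rho0 b; rewrite -/(f b).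
  lra.
have var s k : ~~ wraps s k ->
    `|W (grid_shift s k) - W k| <= L * (11 / 10 * (g * Num.sqrt d%:R)).
  move=> nw; rewrite (le_trans (FL _ _ (xS _) (xS _)))// ler_wpM2l ?(ltW L0)//.
  rewrite (le_trans (sphere_point_lipschitz _ _))// ler_wpM2l//.
  by rewrite /x grid_point_shift// addrAC subrr add0r l2norm_scale ?(ltW g0)// l2norm_sign_vec.
have A0 : 0 <= L * (11 / 10 * (g * Num.sqrt d%:R)).
  rewrite mulr_ge0 ?(ltW L0)// mulr_ge0//.
  by rewrite mulr_ge0 ?sqrtr_ge0 ?(ltW g0).
have := avg_test_upper eps0 rho0 d1 M0 (W := W) A0 lower var normW.
set b := Num.sqrt d%:R.
have b0 : 0 < b by rewrite sqrtr_gt0.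
have b2 : b ^+ 2 = d%:R by rewrite sqr_sqrtr// ltW.
have ab : a <= 101 / 100 * b.
  rewrite -ler_sqr ?nnegrE ?(ltW a0) ?mulr_ge0 ?(ltW b0)// exprMn a2 b2 nd.
  have : 1295%:R <= d%:R :> R by rewrite ler_nat.
  lra.
(* the bound of [avg_test_upper], relative to rho: the first term is at most
   0.46, the second, due to the walls of the box, at most 0.02 *)
have -> : rho / (eps / 2) * (5 / 7) *
    (L * (11 / 10 * (g * b)) + 4 * (3 / 2 * rho) * d%:R / M%:R) =
    rho * (22 / 49 * (a / b) + 60 / 49 * (a * d%:R / (L * M%:R))).
  rewrite {1}/rho /g /mesh -b2; field.
  by rewrite !gt_eqF.
rewrite [leLHS]mulrC ler_pM2l// leNgt => /negP; apply.
have h1 : a / b <= 101 / 100 by rewrite ler_pdivrMr.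
have h2 : a * d%:R / (L * M%:R) <= 100^-1.
  rewrite ler_pdivrMr ?mulr_gt0// MRE.
  have h3 : a * d%:R <= n * n.
    by rewrite ler_pM ?(ltW a0) ?(ltW d0)// nd; lra.
  have nn : 0 <= n * n by rewrite mulr_ge0 ?(ltW n0).
  have := ler_wpM2r nn L1; lra.
lra.
Qed.
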